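(* Let $p$ be a prime and let $2 \leq r \leq p-1$. Then there is an explicit isomorphism of representations of $G(\mathbb{F}_p)=\mathrm{GL}_2(\mathbb{F}_p)$, defined over $\mathbb{F}_{p^2}$, $$\frac{V_{r+p-1}}{D(V_r)} \otimes V_{p-1} \simeq \mathrm{ind}_{T(\mathbb{F}_p)}^{G(\mathbb{F}_p)} \, \omega_2^{r}.$$ Explicitly, it is induced by the map $P\otimes Q\mapsto\psi_{P\otimes Q}$ (for $P\in V_{r+p-1}$, $Q\in V_{p-1}$) given by $$\psi_{P\otimes Q}\left(\begin{pmatrix} a & b\\ c & d\end{pmatrix}\right)=\Big(\nabla_\alpha^{r-2}(P)(A^p,B^p)-\nabla_\alpha^{r-2}(P)(A,B)\Big)\cdot Q(A^p,B^p),$$ where $A=a+c\alpha$, $B=b+d\alpha$ and $\nabla_\alpha=A\frac{\partial}{\partial X}+B\frac{\partial}{\partial Y}$ (with $A,B$ treated as constants).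
   Context: For $n\ge 0$, $V_n$ is the $n$-th symmetric power of the standard representation of $G(\mathbb{F}_p)$, identified with homogeneous polynomials $P(X,Y)$ of degree $n$ over $\mathbb{F}_p$, with action $\begin{pmatrix} a & b\\ c & d\end{pmatrix}\cdot P(X,Y)=P(aX+cY,bX+dY)$; scalars are extended to $\mathbb{F}_{p^2}$ on the left-hand side of the isomorphism. $D=X^p\frac{\partial}{\partial X}+Y^p\frac{\partial}{\partial Y}$, a $G(\mathbb{F}_p)$-linear map $V_n\to V_{n+p-1}$. Fix $\alpha\in\mathbb{F}_{p^2}\setminus\mathbb{F}_p$ with $\alpha^2\in\mathbb{F}_p$. $T(\mathbb{F}_p)\subset G(\mathbb{F}_p)$ is the anisotropic torus, the image of the embedding $i:\mathbb{F}_{p^2}^\times\hookrightarrow G(\mathbb{F}_p)$, $u+v\alpha\mapsto\begin{pmatrix} u & v\alpha^2\\ v & u\end{pmatrix}$ ($u,v\in\mathbb{F}_p$ not both zero), and $\omega_2:T(\mathbb{F}_p)\to\mathbb{F}_{p^2}^\times$ is the inverse of $i$. For a character $\chi:T(\mathbb{F}_p)\to\mathbb{F}_{p^2}^\times$, $\mathrm{ind}_{T(\mathbb{F}_p)}^{G(\mathbb{F}_p)}\chi$ is the space of functions $f:G(\mathbb{F}_p)\to\mathbb{F}_{p^2}$ with $f(tg)=\chi(t)f(g)$ for $t\in T(\mathbb{F}_p)$, with $G(\mathbb{F}_p)$ acting by right translation. *)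

(* Defs.v *)
From HB Require Import structures.
From mathcomp Require Import all_boot all_order all_algebra all_fingroup ring.
From mathcomp.multinomials Require Import mpoly.

Set Implicit Arguments.
Unset Strict Implicit.
Unset Printing Implicit Defensive.

Import GRing.Theory.
Local Open Scope ring_scope.
Local Open Scope quotient_scope.

Record representation (gT : finGroupType) (K : fieldType) (V : lmodType K) :=
  Representation {
    rep_act :> gT -> V -> V;
    rep_linear : forall g, linear (rep_act g);
    rep1 : forall v, rep_act 1%g v = v;
    repM : forall g h v, rep_act (g * h)%g v = rep_act g (rep_act h v)
  }.

Definition rep_isomorphism (gT : finGroupType) (K : fieldType)
    (U V : lmodType K) (rU : representation gT U) (rV : representation gT V)
    (f : U -> V) : Prop :=
  [/\ linear f, bijective f & forall g u, f (rU g u) = rV g (f u)].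

Section QuotientSpace.
Variables (K : fieldType) (V : vectType K) (W : {vspace V}).

Definition vquot : Type := Quotient.quot (pred_of_vspace W).
HB.instance Definition _ := GRing.Zmodule.on vquot.

Definition vproj (v : V) : vquot := \pi_(Quotient.quot (pred_of_vspace W)) v.
Definition vlift (x : vquot) : V := generic_quotient.repr (x : Quotient.quot (pred_of_vspace W)).

Lemma vliftK x : vproj (vlift x) = x.
Proof. exact: reprK. Qed.

Lemma vprojP u v : reflect (vproj u = vproj v) (u - v \in W).
Proof.
by rewrite (Quotient.idealrBE (pred_of_vspace W) u v); exact: eqP.
Qed.

Lemma vprojD : {morph vproj : u v / u + v}.
Proof. by move=> u v; rewrite /vproj; exact: raddfD. Qed.

Definition vquot_scale (a : K) (x : vquot) : vquot := vproj (a *: vlift x).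

Lemma vquot_scale_proj a v : vquot_scale a (vproj v) = vproj (a *: v).
Proof.
by apply/vprojP; rewrite -scalerBr memvZ //; apply/vprojP; rewrite vliftK.
Qed.

Fact vquot_scaleA a b x : vquot_scale a (vquot_scale b x) = vquot_scale (a * b) x.
Proof. by rewrite -(vliftK x) !vquot_scale_proj scalerA. Qed.
Fact vquot_scale1 : left_id 1 vquot_scale.
Proof. by move=> x; rewrite -(vliftK x) vquot_scale_proj scale1r. Qed.
Fact vquot_scaleDr : right_distributive vquot_scale +%R.
Proof.
move=> a x y; rewrite -(vliftK x) -(vliftK y).
by rewrite -vprojD !vquot_scale_proj scalerDr vprojD.
Qed.
Fact vquot_scaleDl x : {morph vquot_scale^~ x : a b / a + b}.
Proof.
by move=> a b; rewrite -(vliftK x) !vquot_scale_proj scalerDl vprojD.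
Qed.

HB.instance Definition _ := GRing.Zmodule_isLmodule.Build K vquot
  vquot_scaleA vquot_scale1 vquot_scaleDr vquot_scaleDl.

Fact vproj_is_linear : linear vproj.
Proof.
by move=> a u v; rewrite vprojD; congr (_ + _); rewrite -vquot_scale_proj.
Qed.
HB.instance Definition _ := GRing.isLinear.Build K V vquot _ vproj
  vproj_is_linear.

Let C := (W^C)%VS.

Fact vquot_dim : Vector.axiom (\dim {:subvs_of C}) vquot.
Proof.
pose e := vbasis {:subvs_of C}.
have eC : basis_of fullv e by exact: vbasisP.
pose f (x : vquot) := passmx.rVof e (vsproj C (daddv_pi C W (vlift x))).
have CW : (C :&: W = 0)%VS by rewrite capvC capv_compl.
have CWT : (C + W = fullv)%VS by rewrite addvC addv_complf.
have fp u : f (vproj u) = passmx.rVof e (vsproj C (daddv_pi C W u)).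
  have uW : vlift (vproj u) - u \in W by apply/vprojP; rewrite vliftK.
  have E : daddv_pi C W (vlift (vproj u) - u) = 0.
    have := daddv_pi_add CW (w := vlift (vproj u) - u).
    rewrite CWT memvf => /(_ isT); rewrite [X in _ + X]daddv_pi_id //; last first.
      by rewrite capvC.
    by move=> /(canRL (addrK _)); rewrite subrr.
  rewrite /f; congr (passmx.rVof e (vsproj C _)).
  by apply/eqP; rewrite -subr_eq0 -linearB; apply/eqP.
exists f.
  move=> a x y; rewrite -(vliftK x) -(vliftK y).
  rewrite -[X in f X](linearP vproj) !fp (linearP (daddv_pi C W)).
  by rewrite (linearP (vsproj C)) passmx.rVof_linear.
exists (fun r => vproj (vsval (passmx.vecof e r))) => [x|r].
  rewrite -(vliftK x) fp passmx.rVofK // vsprojK ?memv_pi //.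
  apply/vprojP; rewrite -memvN opprB.
  have E := daddv_pi_add CW (w := vlift x).
  rewrite CWT memvf in E; have {}E := E isT.
  by rewrite -{1}E addrC addKr memv_pi.
by rewrite fp daddv_pi_id ?subvsP // vsvalK passmx.vecofK //.
Qed.
HB.instance Definition _ := Lmodule_hasFinDim.Build K vquot vquot_dim.

Variables (gT : finGroupType) (rho : representation gT V).
Hypothesis stableW : forall g v, v \in W -> rho g v \in W.

Definition quot_act (g : gT) (x : vquot) : vquot := vproj (rho g (vlift x)).

Lemma rep_actB g u v : rho g (u - v) = rho g u - rho g v.
Proof.
by rewrite -[u - v]addrC -scaleN1r (rep_linear rho) scaleN1r addrC.
Qed.

Lemma quot_act_proj g v : quot_act g (vproj v) = vproj (rho g v).
Proof.
apply/vprojP; rewrite -rep_actB; apply: stableW.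
by apply/vprojP; rewrite vliftK.
Qed.

Fact quot_act_linear g : linear (quot_act g).
Proof.
move=> a x y; rewrite -(vliftK x) -(vliftK y) -[X in quot_act g X](linearP vproj).
by rewrite !quot_act_proj (rep_linear rho) linearP.
Qed.
Fact quot_act1 x : quot_act 1%g x = x.
Proof. by rewrite /quot_act rep1 vliftK. Qed.
Fact quot_actM g h x : quot_act (g * h)%g x = quot_act g (quot_act h x).
Proof. by rewrite -(vliftK x) !quot_act_proj repM. Qed.

Definition quot_rep := Representation quot_act_linear quot_act1 quot_actM.

End QuotientSpace.

(* Tensor product of two finite-dimensional vector spaces: U (x) V is modelled
   by matrices in the bases vbasis fullv, with (u (x) v)_ij = u_i v_j.   Lemmas
   tensor_lift_pure and tensor_ext are its universal property.                *)

Section Tensor.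
Variables (K : fieldType) (U V : vectType K).

Definition tensor : Type := 'M[K]_(\dim {:U}, \dim {:V}).
HB.instance Definition _ := Vector.on tensor.

Definition pure (u : U) (v : V) : tensor := 
  \matrix_(i, j) (coord (vbasis {:U}) i u * coord (vbasis {:V}) j v).

Definition bilinear_map (W : lmodType K) (b : U -> V -> W) : Prop :=
  (forall u, linear (b u)) /\ (forall v, linear (b^~ v)).

Definition tensor_lift (W : lmodType K) (b : U -> V -> W) (x : tensor) : W :=
  \sum_i \sum_j x i j *: b (vbasis {:U})`_i (vbasis {:V})`_j.

Lemma pure_bilinear : bilinear_map pure.
Proof.
split=> [u|v] a x y; apply/matrixP=> i j; rewrite !mxE linearP.
  by rewrite mulrDr mulrCA.
by rewrite mulrDl mulrA.
Qed.

Lemma tensor_lift_linear (W : lmodType K) (b : U -> V -> W) :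
  linear (tensor_lift b).
Proof.
move=> a x y; rewrite /tensor_lift scaler_sumr -big_split /=.
apply: eq_bigr => i _; rewrite scaler_sumr -big_split /=.
by apply: eq_bigr => j _; rewrite !mxE scalerDl scalerA.
Qed.

Lemma vbasis_sum (V' : vectType K) (v : V') :
  v = \sum_i coord (vbasis {:V'}) i v *: (vbasis {:V'})`_i.
Proof. exact: coord_vbasis (memvf v). Qed.

Lemma linear_fun_sum (V1 V2 : lmodType K) (f : V1 -> V2) (I : finType)
    (c : I -> K) (e : I -> V1) :
  linear f -> f (\sum_i c i *: e i) = \sum_i c i *: f (e i).
Proof.
move=> lf; pose fL := GRing.isLinear.Build K V1 V2 *:%R f lf.
pose f' : {linear V1 -> V2} := HB.pack f fL.
rewrite -[f]/(f' : _ -> _) linear_sum /=.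
by apply: eq_bigr => i _; apply: (linearZ_LR f').
Qed.

Lemma tensor_lift_pure (W : lmodType K) (b : U -> V -> W) u v :
  bilinear_map b -> tensor_lift b (pure u v) = b u v.
Proof.
case=> lr ll; rewrite [in RHS](vbasis_sum u) (linear_fun_sum _ _ (ll v)).
apply: eq_bigr => i _; rewrite [in RHS](vbasis_sum v) (linear_fun_sum _ _ (lr _)).
rewrite scaler_sumr; apply: eq_bigr => j _.
by rewrite scalerA mxE.
Qed.

Lemma tensorE (x : tensor) : x = tensor_lift pure x.
Proof.
apply/matrixP=> k l; rewrite /tensor_lift summxE (bigD1 k) //= summxE (bigD1 l) //=.
have E i j : (x i j *: pure (vbasis {:U})`_i (vbasis {:V})`_j) k l
    = x i j * ((i == k)%:R * (j == l)%:R).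
  by rewrite !mxE !coord_free ?(basis_free (vbasisP _)).
rewrite E !eqxx !mulr1 big1 => [|j nj]; last first.
  by rewrite E eqxx (negbTE nj) !mulr0.
rewrite addr0 big1 ?addr0 // => i ni; rewrite summxE big1 // => j _.
by rewrite E (negbTE ni) mul0r mulr0.
Qed.

Lemma tensor_ext (W : lmodType K) (f1 f2 : tensor -> W) :
  linear f1 -> linear f2 -> (forall u v, f1 (pure u v) = f2 (pure u v)) ->
  f1 =1 f2.
Proof.
move=> l1 l2 E x; rewrite (tensorE x) /tensor_lift pair_big /=.
rewrite (linear_fun_sum (fun ij => x ij.1 ij.2)
           (fun ij => pure (vbasis {:U})`_ij.1 (vbasis {:V})`_ij.2) l1).
rewrite (linear_fun_sum (fun ij => x ij.1 ij.2)
           (fun ij => pure (vbasis {:U})`_ij.1 (vbasis {:V})`_ij.2) l2).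
by apply: eq_bigr => ij _; rewrite E.
Qed.

Variables (gT : finGroupType).
Variables (rU : representation gT U) (rV : representation gT V).

Definition tensor_act (g : gT) : tensor -> tensor :=
  tensor_lift (fun u v => pure (rU g u) (rV g v)).

Lemma tensor_act_pure g u v : tensor_act g (pure u v) = pure (rU g u) (rV g v).
Proof.
apply: tensor_lift_pure; split=> [{}u|{}v] a x y; rewrite rep_linear.
  by case: pure_bilinear => lr _; rewrite lr.
by case: pure_bilinear => _ ll; rewrite ll.
Qed.

Fact tensor_act_linear g : linear (tensor_act g).
Proof. exact: tensor_lift_linear. Qed.
Fact tensor_act1 x : tensor_act 1%g x = x.
Proof.
apply: (tensor_ext (tensor_act_linear 1) (f2 := id)) => // u v.
by rewrite tensor_act_pure !rep1.
Qed.
Fact tensor_actM g h x : tensor_act (g * h)%g x = tensor_act g (tensor_act h x).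
Proof.
apply: (tensor_ext (tensor_act_linear _) (f2 := tensor_act g \o tensor_act h)).
  by move=> a y z /=; rewrite !tensor_act_linear.
by move=> u v /=; rewrite !tensor_act_pure !repM.
Qed.

Definition tensor_rep := Representation tensor_act_linear tensor_act1 tensor_actM.

End Tensor.

Section Induced.
Variables (gT : finGroupType) (K : fieldType) (T : {set gT}) (chi : gT -> K).

Definition ind_pred : {pred {ffun gT -> K^o}} :=
  [pred f : {ffun gT -> K^o} |
    [forall t in T, forall g, f (t * g)%g == chi t * f g]].

Lemma ind_predP (f : {ffun gT -> K^o}) :
  reflect (forall t g, t \in T -> f (t * g)%g = chi t * f g) (f \in ind_pred).
Proof.
apply: (iffP forall_inP) => [H t g tT | H t tT].
  by apply/eqP; move/forallP: (H t tT).
by apply/forallP=> g; apply/eqP/H.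
Qed.

Fact ind_submod_closed : submod_closed ind_pred.
Proof.
split=> [|a f1 f2 /ind_predP H1 /ind_predP H2]; apply/ind_predP => t g tT.
  by rewrite !ffunE mulr0.
by rewrite !ffunE H1 // H2 // mulrDr; congr (_ + _); rewrite /GRing.scale /= mulrCA.
Qed.
HB.instance Definition _ := GRing.isSubmodClosed.Build K {ffun gT -> K^o}
  ind_pred ind_submod_closed.

Record ind := Ind { ind_fun :> {ffun gT -> K^o}; _ : ind_fun \in ind_pred }.
HB.instance Definition _ := [isSub for ind_fun].
HB.instance Definition _ := [Choice of ind by <:].
HB.instance Definition _ := [SubChoice_isSubLmodule of ind by <:].

Lemma ind_equivariant (f : ind) t g : t \in T -> f (t * g)%g = chi t * f g.
Proof. by case: f => f /= /ind_predP; apply. Qed.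

Fact ind_act_subproof (h : gT) (f : ind) :
  [ffun g => f (g * h)%g] \in ind_pred.
Proof.
by apply/ind_predP => t g tT; rewrite !ffunE -mulgA; exact: ind_equivariant.
Qed.

Definition ind_act (h : gT) (f : ind) : ind := Ind (ind_act_subproof h f).

Fact ind_act_linear h : linear (ind_act h).
Proof. by move=> a f1 f2; apply/val_inj/ffunP=> g; rewrite !ffunE. Qed.
Fact ind_act1 f : ind_act 1%g f = f.
Proof. by apply/val_inj/ffunP=> g; rewrite ffunE mulg1. Qed.
Fact ind_actM h k f : ind_act (h * k)%g f = ind_act h (ind_act k f).
Proof. by apply/val_inj/ffunP=> g; rewrite !ffunE mulgA. Qed.

Definition ind_rep := Representation ind_act_linear ind_act1 ind_actM.

End Induced.

Section GL2.
Variables (p : nat) (L : fieldType) (iota : {rmorphism 'F_p -> L}).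
Local Notation GL2 := {'GL_2['F_p]}.

(* The symmetric power V_n with scalars extended to L: homogeneous
   polynomials of degree n over L in X = 'X_0 and Y = 'X_1.                   *)
Definition Vsym (n : nat) := dhomog 2 L n.

Definition sym_subst (g : GL2) : 2.-tuple {mpoly L[2]} :=
  [tuple iota (GLval g 0 0) *: 'X_0 + iota (GLval g 1 0) *: 'X_1;
         iota (GLval g 0 1) *: 'X_0 + iota (GLval g 1 1) *: 'X_1].

Lemma homogX (j : 'I_2) : ('X_j : {mpoly L[2]}) \is 1.-homog.
Proof. by rewrite dhomogX; apply/eqP; rewrite /= mdeg1. Qed.

Fact sym_act_subproof n (g : GL2) (P : Vsym n) :
  (P : {mpoly L[2]}) \mPo sym_subst g \is n.-homog.
Proof.
have hg i : tnth (sym_subst g) i \is 1.-homog.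
  by case: i => [[|[|//]] hi]; rewrite (tnth_nth 0) /= rpredD // rpredZ // homogX.
case: P => P hP /=; rewrite comp_mpolyE big_seq rpred_sum // => m mP.
rewrite rpredZ // big_ord_recl big_ord1.
have := dhomog_mf hP mP; rewrite /= mdegE big_ord_recl big_ord1 => <-.
by apply: dhomogM; [have := dhomogMn (m ord0) (hg ord0)
  | have := dhomogMn (m (lift ord0 ord0)) (hg (lift ord0 ord0))]; rewrite mul1n.
Qed.

Definition sym_act n (g : GL2) (P : Vsym n) : Vsym n :=
  DHomog (sym_act_subproof g P).

Fact sym_act_linear n g : linear (@sym_act n g).
Proof. by move=> a P Q; apply/val_inj; rewrite /= linearP. Qed.

Lemma sym_subst_X (g : GL2) (j : 'I_2) :
  tnth (sym_subst g) j = \sum_(i < 2) iota (GLval g i j) *: 'X_i.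
Proof.
rewrite (tnth_nth 0) big_ord_recl big_ord1.
have -> : lift ord0 ord0 = 1 :> 'I_2 by apply/val_inj.
by case: j => [[|[|//]] hj] /=;
  congr (iota (GLval g _ _) *: _ + iota (GLval g _ _) *: _); apply/val_inj.
Qed.

Lemma comp_mpolyA (P : {mpoly L[2]}) (s t u : 2.-tuple {mpoly L[2]}) :
  (forall i, tnth u i = tnth s i \mPo t) -> (P \mPo s) \mPo t = P \mPo u.
Proof.
move=> E; rewrite [P \mPo s]comp_mpolyE [RHS]comp_mpolyE linear_sum /=.
apply: eq_bigr => m _; rewrite comp_mpolyZ rmorph_prod /=.
by congr (_ *: _); apply: eq_bigr => i _; rewrite E rmorphXn.
Qed.

Fact sym_act1 n (P : Vsym n) : sym_act 1%g P = P.
Proof.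
apply/val_inj => /=; rewrite -[RHS]comp_mpoly_id; congr (_ \mPo _).
apply: eq_from_tnth => j; rewrite sym_subst_X tnth_mktuple (bigD1 j) //=.
rewrite big1 => [|i nij]; rewrite mxE ?eqxx ?rmorph1 ?scale1r ?addr0 //.
by rewrite (negbTE nij) rmorph0 scale0r.
Qed.

Fact sym_actM n g h (P : Vsym n) : sym_act (g * h)%g P = sym_act g (sym_act h P).
Proof.
apply/val_inj => /=; symmetry; apply: comp_mpolyA => j.
rewrite !sym_subst_X linear_sum /=.
under [RHS]eq_bigr => i _.
  rewrite comp_mpolyZ comp_mpolyXU -tnth_nth sym_subst_X scaler_sumr.
  under eq_bigr => k _ do rewrite scalerA -rmorphM mulrC.
  over.
rewrite exchange_big /=; apply: eq_bigr => k _.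
by rewrite -scaler_suml -rmorph_sum; congr (iota _ *: _); rewrite mxE.
Qed.

Definition Vsym_rep n := Representation (@sym_act_linear n) (@sym_act1 n) (@sym_actM n).

Definition Dop (P : {mpoly L[2]}) : {mpoly L[2]} :=
  'X_0 ^+ p * P^`M(0) + 'X_1 ^+ p * P^`M(1).

Hypothesis p_pr : prime p.

Fact Dop_homog n (P : Vsym n) :
  Dop (P : {mpoly L[2]}) \is (n + p - 1).-homog.
Proof.
have dP i : 'X_i ^+ p * (P : {mpoly L[2]})^`M(i) \is (n + p - 1).-homog.
  case: P => P hP /=; rewrite [P]mpolyE raddf_sum mulr_sumr /= big_seq rpred_sum //.
  move=> m mP; rewrite mderivZ mderivX -!scalerAr.
  have [m0|m0] := eqVneq (m i) 0%N; first by rewrite m0 scale0r scaler0 rpred0.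
  rewrite !rpredZ //; have := dhomog_mf hP mP => /= <-.
  have -> : (mdeg m + p - 1 = p + (mdeg m - 1))%N.
    by rewrite addnC addnBA // mdegE (bigD1 i) //= addn_gt0 lt0n m0.
  apply: dhomogM; first by have := dhomogMn p (homogX i); rewrite mul1n.
  have hm : (U_(i) <= m)%MM by rewrite lep1mP.
  by rewrite dhomogX /= -[in X in _ == (X - 1)%N](submK hm) mdegD mdeg1 addnK.
by apply: rpredD; apply: dP.
Qed.

Definition Dmap n (P : Vsym n) : Vsym (n + p - 1) := DHomog (Dop_homog P).

Fact Dmap_linear n : linear (@Dmap n).
Proof.
move=> a P Q; apply/val_inj; rewrite /= /Dop !linearP /=.
by rewrite !mulrDr -!scalerAr scalerDr addrACA.
Qed.

Lemma DopM P Q : Dop (P * Q) = Dop P * Q + P * Dop Q.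
Proof.
rewrite /Dop !mderivM !mulrDr !mulrDl !mulrA ![P * 'X_ _ ^+ _]mulrC.
by rewrite addrACA.
Qed.

Lemma Dop_is_linear : linear Dop.
Proof.
move=> a P Q; rewrite /Dop !linearP /=.
by rewrite !mulrDr -!scalerAr scalerDr addrACA.
Qed.
HB.instance Definition _ := GRing.isLinear.Build L {mpoly L[2]} {mpoly L[2]} _
  Dop Dop_is_linear.

Lemma DopD P Q : Dop (P + Q) = Dop P + Dop Q.
Proof. exact: linearD. Qed.

Lemma DopZ a P : Dop (a *: P) = a *: Dop P.
Proof. exact: linearZ. Qed.

Lemma DopX (j : 'I_2) : Dop 'X_j = 'X_j ^+ p.
Proof.
have E (i : 'I_2) : ('X_j : {mpoly L[2]})^`M(i) = (i == j)%:R.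
  rewrite mderivX mnm1E eq_sym; case: eqP => [->|_]; last by rewrite scale0r.
  rewrite scale1r -[RHS]mpolyX0; congr 'X_[_].
  by apply/mnmP=> k; rewrite !mnmE subnn.
rewrite /Dop !E; case: j {E} => [[|[|//]] hj] /=.
  by rewrite mulr1 mulr0 addr0; congr ('X_ _ ^+ _); apply/val_inj.
by rewrite mulr1 mulr0 add0r; congr ('X_ _ ^+ _); apply/val_inj.
Qed.

Lemma pchar_mpoly : p \in [pchar {mpoly L[2]}].
Proof.
have pL : p \in [pchar L] by rewrite (fmorph_pchar iota) pchar_Fp.
by rewrite inE p_pr /= -mpolyC_nat (pcharf0 pL).
Qed.

Lemma iotaXp (x : 'F_p) : iota x ^+ p = iota x.
Proof.
rewrite -rmorphXn /= -[x in LHS]natr_Zp -[x in RHS]natr_Zp.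
by rewrite -(pFrobenius_autE (pchar_Fp p_pr)) pFrobenius_aut_nat.
Qed.

Lemma Dop_comp (g : GL2) (P : {mpoly L[2]}) :
  Dop (P \mPo sym_subst g) = Dop P \mPo sym_subst g.
Proof.
pose s := sym_subst g.
pose good Q := Dop (Q \mPo s) = Dop Q \mPo s.
have Dop1 : Dop 1 = 0.
  have := DopM 1 1; rewrite !mulr1 mul1r => /(canLR (addrK _)).
  by rewrite subrr.
have good1 : good 1 by rewrite /good rmorph1 Dop1 rmorph0.
have goodM Q1 Q2 : good Q1 -> good Q2 -> good (Q1 * Q2).
  rewrite /good => h1 h2; rewrite rmorphM /= !DopM h1 h2. by rewrite [RHS]comp_mpolyD; congr (_ + _); rewrite [RHS]rmorphM.
have goodX j : good 'X_j.
  rewrite /good DopX rmorphXn /= comp_mpolyXU -tnth_nth sym_subst_X.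
  rewrite linear_sum -(pFrobenius_autE pchar_mpoly) rmorph_sum /=.
  apply: eq_bigr => i _; rewrite linearZ /= DopX pFrobenius_autE.
  by rewrite exprZn iotaXp.
have goodD Q1 Q2 : good Q1 -> good Q2 -> good (Q1 + Q2).
  rewrite /good => h1 h2.
  by rewrite comp_mpolyD !DopD h1 h2 [RHS]comp_mpolyD.
have goodZ a Q : good Q -> good (a *: Q).
  by rewrite /good => h; rewrite comp_mpolyZ !DopZ h comp_mpolyZ.
rewrite -/s -/(good P) [P]mpolyE; elim/big_ind: _ => //.
  by rewrite -(scale0r 1); exact: goodZ.
move=> m _; apply: goodZ.
rewrite mpolyXE_id; elim/big_ind: _ => // j _.
by elim: (m j) => [|k IH]; rewrite ?expr0 // exprS; apply: goodM.
Qed.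

Lemma Dmap_equivariant n (g : GL2) (P : Vsym n) :
  Dmap (sym_act g P) = sym_act g (Dmap P).
Proof. by apply/val_inj; exact: Dop_comp. Qed.

HB.instance Definition _ n :=
  GRing.isLinear.Build L (Vsym n) (Vsym (n + p - 1)) _ (@Dmap n) (@Dmap_linear n).

Definition DV n : {vspace Vsym (n + p - 1)} := limg (linfun (@Dmap n)).

Lemma DV_stable n (g : GL2) Q : Q \in DV n -> sym_act g Q \in DV n.
Proof.
case/memv_imgP=> P _ ->; apply/memv_imgP; exists (sym_act g P); first exact: memvf.
by rewrite !lfunE /= Dmap_equivariant.
Qed.

Definition Vquot n := vquot (DV n).
Definition Vquot_rep n : representation GL2 (Vquot n) :=
  quot_rep (rho := Vsym_rep (n + p - 1)) (@DV_stable n).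

Variable alpha : L.

(* g is the image of u + v alpha under the embedding i : L^* -> GL_2(F_p),
   with rows (u, v alpha^2) and (v, u), where v alpha^2 is compared in L.     *)
Definition is_torus_elt (u v : 'F_p) (g : GL2) : bool :=
  [&& GLval g 0 0 == u, iota (GLval g 0 1) == iota v * alpha ^+ 2,
      GLval g 1 0 == v & GLval g 1 1 == u].

Definition torus : {set GL2} :=
  [set g | [exists u, exists v, is_torus_elt u v g]].

(* The inverse of i on the torus, see omega2_torus_elt.                       *)
Definition omega2 (g : GL2) : L := iota (GLval g 0 0) + iota (GLval g 1 0) * alpha.

Lemma omega2_torus_elt u v g :
  is_torus_elt u v g -> omega2 g = iota u + iota v * alpha.
Proof. by case/and4P => /eqP E1 _ /eqP E2 _; rewrite /omega2 E1 E2. Qed.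

Lemma torus_elt_exists u v :
  alpha \notin codom iota -> alpha ^+ 2 \in codom iota -> (u, v) != (0, 0) ->
  exists2 g, g \in torus & is_torus_elt u v g.
Proof.
move=> aNF /codomP[a Ea] uv0.
pose M : 'M['F_p]_2 := \matrix_(i, j)
  if i == 0 then (if j == 0 then u else v * a) else (if j == 0 then v else u).
have detM : \det M = u ^+ 2 - v ^+ 2 * a.
  rewrite (expand_det_row _ 0) !big_ord_recl big_ord0 addr0 /cofactor !det_mx11 !mxE /=.
  by rewrite expr0 expr1 !mul1r mulN1r mulrN expr2 expr2 mulrAC.
have Mu : M \in unitmx.
  rewrite unitmxE unitfE detM subr_eq0; apply: contraNneq aNF => E.
  have E' : iota u ^+ 2 = (iota v * alpha) ^+ 2.
    by rewrite exprMn Ea -!rmorphXn -rmorphM /= E.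
  have v0 : v != 0.
    apply: contraNneq uv0 => v0; move/eqP: E.
    by rewrite v0 expr0n mul0r sqrf_eq0 => /eqP ->.
  have iv0 : iota v != 0 by rewrite fmorph_eq0.
  move/eqP: E'; rewrite eqf_sqr => /orP[] /eqP E'.
    apply/codomP; exists (u / v).
    by rewrite fmorph_div E' mulrC mulKf.
  apply/codomP; exists (- (u / v)).
  by rewrite rmorphN fmorph_div E' mulNr opprK mulrC mulKf.
have H : is_torus_elt u v (Sub M Mu : GL2).
  by rewrite /is_torus_elt SubK !mxE /= !eqxx rmorphM Ea eqxx.
exists (Sub M Mu) => //; rewrite inE; apply/existsP; exists u.
by apply/existsP; exists v.
Qed.

Lemma omega2M s t : s \in torus -> omega2 (s * t)%g = omega2 s * omega2 t.
Proof.
rewrite inE => /existsP[u /existsP[v H]]; rewrite (omega2_torus_elt H).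
case/and4P: H => /eqP E1 /eqP E2 /eqP E3 /eqP E4.
have E0 : lift ord0 ord0 = 1 :> 'I_2 by apply/val_inj.
rewrite /omega2 GL_MxE !mxE !big_ord_recl !big_ord0 !E0 !addr0.
rewrite !rmorphD !rmorphM /= E1 E2 E3 E4.
by ring.
Qed.

Definition nabla (A B : L) (P : {mpoly L[2]}) : {mpoly L[2]} :=
  A *: P^`M(0) + B *: P^`M(1).

Definition psi (r : nat) (P Q : {mpoly L[2]}) (g : GL2) : L :=
  let A := iota (GLval g 0 0) + iota (GLval g 1 0) * alpha in
  let B := iota (GLval g 0 1) + iota (GLval g 1 1) * alpha in
  let nablaP := iter (r - 2) (nabla A B) P in
  (nablaP.@[tnth [tuple A ^+ p; B ^+ p]] - nablaP.@[tnth [tuple A; B]])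
  * Q.@[tnth [tuple A ^+ p; B ^+ p]].

End GL2.

(* Main.v *)
From HB Require Import structures.
Require Import Defs.
From mathcomp Require Import all_boot all_order all_algebra all_fingroup.
From mathcomp Require Import finfield ring zify.
From mathcomp.multinomials Require Import mpoly.

(** Write A and B for the entries of (1, alpha) g, k for r - 2, m for
    r + p - 1 and nabla for A d/dX + B d/dY; the map is
    P (x) Q |-> (nabla^k P (A^p, B^p) - nabla^k P (A, B)) Q(A^p, B^p).

    It is well defined on V_m / D(V_r): since nabla kills p-th powers, it
    commutes with D, so nabla^k (D R) = D S with S a quadratic form, and D S
    takes the value 2 S~((A, B), (A^p, B^p)) at both points, where S~ is the
    polar form of S; this is symmetric in a point and its conjugate because
    x^(p^2) = x in L ([conj_diff_Dop]).  The left action of the torus multiplies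
    (A, B) by a scalar of L, so that homogeneity gives the character omega_2^r
    ([psi_torus]), and the chain rule gives G-equivariance
    ([psi_equivariant]).

    For bijectivity, every form of degree m is modulo D(V_r) a combination
    of the X^i Y^(m-i) with 0 < i < p ([homog_mod_Dop]), so the source is spanned
    by the p(p - 1) tensors X^i Y^(m-i) (x) X^j Y^(p-1-j) with
    0 < i < p and 0 <= j < p ([tensor_span]).  Elements of the target are
    determined by their values at the g with B = 1, that is at A = w^p with w
    in L \ F_p ([ind_ext]), and there are p^2 - p of these ([card_chart]).  The
    tensor with indices (i, j) takes at such a g the value at w of a polynomial
    of degree exactly p i + j ([size_basis_poly]).  These degrees are pairwise
    distinct and less than p^2, and all these polynomials vanish on F_p; hence
    a combination of them that vanishes on L \ F_p vanishes on L, is therefore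
    the zero polynomial, and has zero coefficients ([psi_tensor_free]).  As the
    p(p - 1) spanning tensors have linearly independent images, and the target
    is no larger than L^(p(p - 1)), the map is bijective ([psi_tensor_bij]).

    That the degree does not drop below p i + j is the one computation in the
    proof: the coefficient of w^(p i) in the first factor is -(r - 2)! i when
    i <= r - 2 and -(r - 1)! otherwise, and neither vanishes modulo p
    ([coef_psi_poly]). *)

Set Implicit Arguments.
Unset Strict Implicit.
Unset Printing Implicit Defensive.

Import GRing.Theory.
Local Open Scope ring_scope.

Lemma ord2_ind (P : 'I_2 -> Prop) : P 0 -> P 1 -> forall j, P j.
Proof.
move=> P0 P1 [[|[|//]] hj].
  by have -> : Ordinal hj = 0 by apply/val_inj.
by have -> : Ordinal hj = 1 by apply/val_inj.
Qed.

Lemma sum2 (V : nmodType) (F : 'I_2 -> V) : \sum_(i < 2) F i = F 0 + F 1.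
Proof.
by rewrite !big_ord_recl big_ord0 addr0; congr (F _ + F _); apply/val_inj.
Qed.

Lemma det2 (R : comNzRingType) (M : 'M[R]_2) :
  \det M = M 0 0 * M 1 1 - M 0 1 * M 1 0.
Proof.
rewrite (expand_det_row _ 0) sum2 /cofactor !det_mx11 !mxE /=.
rewrite expr0 expr1 mul1r mulN1r mulrN.
by congr (_ * M _ _ - _ * M _ _); apply/val_inj.
Qed.

(** * Directional derivatives of binary forms *)

Section BinaryForms.
Variable L : fieldType.
Implicit Types (P Q : {mpoly L[2]}) (A B x y : L).

Definition mon i j : {mpoly L[2]} := 'X_[[multinom [tuple i; j]]].

Lemma monE (m : 'X_{1..2}) : 'X_[m] = mon (m 0) (m 1).
Proof.
by congr 'X_[_]; apply/mnmP; apply: ord2_ind; rewrite multinomE.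
Qed.

Lemma mdeg2 (m : 'X_{1..2}) : mdeg m = (m 0%R + m 1%R)%N.
Proof.
rewrite mdegE !big_ord_recl big_ord0 addn0.
by congr (m _ + m _)%N; apply/val_inj.
Qed.

Lemma mon_homog i j : mon i j \is (i + j).-homog.
Proof. by rewrite dhomogX /= mdeg2. Qed.

Lemma meval_mon x y i j : (mon i j).@[tnth [tuple x; y]] = x ^+ i * y ^+ j.
Proof. by rewrite mevalX !big_ord_recl big_ord0 mulr1. Qed.

Lemma homog_ind n (S : {mpoly L[2]} -> Prop) :
    S 0 -> (forall a P Q, S P -> S Q -> S (a *: P + Q)) ->
    (forall i j, (i + j = n)%N -> S (mon i j)) ->
  forall P, P \is n.-homog -> S P.
Proof.
move=> S0 SD Smon P hP; rewrite [P]mpolyE big_seq.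
apply: (big_rec S) => // m Q mP SQ; apply: (SD _ _ _ _ SQ).
rewrite monE; apply: Smon.
by rewrite -mdeg2 -(dhomog_mf hP mP).
Qed.

Lemma mderiv_mon0 i j : (mon i j)^`M(0) = i%:R *: mon i.-1 j.
Proof.
rewrite mderivX multinomE /=; congr (_ *: 'X_[_]).
by apply/mnmP; apply: ord2_ind; rewrite mnmBE mnm1E !multinomE ?subn1 ?subn0.
Qed.

Lemma mderiv_mon1 i j : (mon i j)^`M(1) = j%:R *: mon i j.-1.
Proof.
rewrite mderivX multinomE /=; congr (_ *: 'X_[_]).
by apply/mnmP; apply: ord2_ind; rewrite mnmBE mnm1E !multinomE ?subn1 ?subn0.
Qed.

Lemma mon_X0 : mon 1 0 = 'X_0.
Proof.
by congr 'X_[_]; apply/mnmP; apply: ord2_ind; rewrite mnm1E !multinomE.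
Qed.

Lemma mon_X1 : mon 0 1 = 'X_1.
Proof.
by congr 'X_[_]; apply/mnmP; apply: ord2_ind; rewrite mnm1E !multinomE.
Qed.

Lemma monM i j k l : mon i j * mon k l = mon (i + k) (j + l).
Proof.
rewrite -mpolyXD; congr 'X_[_]; apply/mnmP.
by apply: ord2_ind; rewrite mnmDE !multinomE.
Qed.

Lemma mon_X0n n : mon n 0 = 'X_0 ^+ n.
Proof.
elim: n => [|n IH]; last by rewrite exprS -IH -mon_X0 monM.
by rewrite -[LHS]mulr1 -[1]/('X_0 ^+ 0) expr0 mulr1 -mpolyX0 monE !mnm0E.
Qed.

Lemma mon_X1n n : mon 0 n = 'X_1 ^+ n.
Proof.
elim: n => [|n IH]; last by rewrite exprS -IH -mon_X1 monM.
by rewrite -[LHS]mulr1 expr0 mulr1 -mpolyX0 monE !mnm0E.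
Qed.

Lemma nabla_is_linear A B : linear (nabla A B).
Proof.
move=> a P Q; rewrite /nabla !mderivD !mderivZ !scalerDr addrACA.
by rewrite !scalerA ![_ * a]mulrC.
Qed.
HB.instance Definition _ A B :=
  GRing.isLinear.Build L {mpoly L[2]} {mpoly L[2]} _ (nabla A B)
    (nabla_is_linear A B).

Lemma nablaD A B P Q : nabla A B (P + Q) = nabla A B P + nabla A B Q.
Proof. exact: linearD. Qed.

Lemma nablaZ A B a P : nabla A B (a *: P) = a *: nabla A B P.
Proof. exact: linearZ. Qed.

Lemma iter_nabla_is_linear k A B : linear (iter k (nabla A B)).
Proof. by elim: k => // k IH a P Q; rewrite iterS IH linearP. Qed.
HB.instance Definition _ k A B :=
  GRing.isLinear.Build L {mpoly L[2]} {mpoly L[2]} _ (iter k (nabla A B))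
    (iter_nabla_is_linear k A B).

Lemma nablaM A B P Q : nabla A B (P * Q) = nabla A B P * Q + P * nabla A B Q.
Proof.
rewrite /nabla !mderivM !scalerDr mulrDl mulrDr -!scalerAl -!scalerAr.
by rewrite addrACA.
Qed.

Lemma nablaX A B (j : 'I_2) : nabla A B 'X_j = (tnth [tuple A; B] j)%:MP.
Proof.
rewrite /nabla -!mul_mpolyC; elim/ord2_ind: j.
  rewrite -mon_X0 mderiv_mon0 mderiv_mon1 scale0r mulr0 addr0 scale1r.
  by rewrite mon_X0n expr0 mulr1.
rewrite -mon_X1 mderiv_mon0 mderiv_mon1 scale0r mulr0 add0r scale1r.
by rewrite mon_X0n expr0 mulr1.
Qed.

(** The direction is constant, so one derivative may be taken first; every
    statement below about iterated derivatives follows from this recursion on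
    the order and the two exponents. *)
Lemma iter_nabla_mon k A B i j :
  iter k.+1 (nabla A B) (mon i j) =
    (A * i%:R) *: iter k (nabla A B) (mon i.-1 j)
    + (B * j%:R) *: iter k (nabla A B) (mon i j.-1).
Proof.
by rewrite iterSr {2}/nabla mderiv_mon0 mderiv_mon1 !scalerA linearD !linearZ.
Qed.

(** Each derivative contributes a factor [l], and [n] is the degree that remains
    after [k] derivatives. *)
Lemma iter_nabla_homothety k n A B x y l m P : P \is (n + k).-homog ->
  (iter k (nabla (l * A) (l * B)) P).@[tnth [tuple m * x; m * y]]
  = l ^+ k * m ^+ n * (iter k (nabla A B) P).@[tnth [tuple x; y]].
Proof.
move: P; apply: homog_ind => [|a P Q hP hQ|i j].
- by rewrite !linear0 ?meval0 mulr0.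
- by rewrite !linearP /= hP hQ mulrDr; congr (_ + _); rewrite mulrCA.
elim: k i j => [|k IH] i j ij.
  by rewrite !meval_mon mul1r !exprMn mulrACA -exprD ij addn0.
rewrite !iter_nabla_mon !mevalD !mevalZ mulrDr.
congr (_ + _).
  case: i ij => [|i] ij; first by rewrite !(mulr0, mul0r).
  by rewrite IH /= ?exprS; [move: (meval _ _) => e; ring | lia].
case: j ij => [|j] ij; first by rewrite !(mulr0, mul0r).
by rewrite IH /= ?exprS; [move: (meval _ _) => e; ring | lia].
Qed.

(** Both operators are derivations with constant or p-th power coefficients, and
    a derivation kills p-th powers in characteristic p. *)
Lemma nabla_Dop p A B P : p \in [pchar L] ->
  nabla A B (Dop p P) = Dop p (nabla A B P).
Proof.
move=> pL; have pM : p \in [pchar {mpoly L[2]}].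
  by rewrite inE (pcharf_prime pL) -mpolyC_nat (pcharf0 pL) /=.
have nablaXp (Q : {mpoly L[2]}) : nabla A B (Q ^+ p) = 0.
  have E n : nabla A B (Q ^+ n.+1) = Q ^+ n * nabla A B Q *+ n.+1.
    elim: n => [|n IH]; first by rewrite expr0 mul1r expr1.
    by rewrite exprS nablaM IH mulrC mulrnAr mulrA -exprS [RHS]mulrS.
  have p0 := prime_gt0 (pcharf_prime pL).
  by rewrite -(prednK p0) E (prednK p0) -mulr_natr (pcharf0 pM) mulr0.
rewrite /Dop linearD /= !nablaM !nablaXp !mul0r !add0r.
by rewrite /nabla !mderivD !mderivZ ![_^`M(1)^`M(0)]mderiv_comm.
Qed.

Lemma iter_nabla_Dop p k A B P : p \in [pchar L] ->
  iter k (nabla A B) (Dop p P) = Dop p (iter k (nabla A B) P).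
Proof. by move=> pL; elim: k => // k IH; rewrite !iterS IH nabla_Dop. Qed.

Lemma Dop_mon p i j :
  Dop p (mon i j) = i%:R *: mon (i.-1 + p) j + j%:R *: mon i (j.-1 + p).
Proof.
rewrite /Dop mderiv_mon0 mderiv_mon1 -!scalerAr -mon_X0n -mon_X1n !monM.
by rewrite !add0n ![(p + _)%N]addnC.
Qed.

(** For [A] and [B] in the field with p^2 elements, [(A ^+ p, B ^+ p)] is the
    conjugate of the point [(A, B)] over the prime field. *)
Definition conj_diff p A B P : L :=
  P.@[tnth [tuple A ^+ p; B ^+ p]] - P.@[tnth [tuple A; B]].

Lemma conj_diffD p A B P Q :
  conj_diff p A B (P + Q) = conj_diff p A B P + conj_diff p A B Q.
Proof. by rewrite /conj_diff !mevalD opprD addrACA. Qed.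

Lemma conj_diffZ p A B a P : conj_diff p A B (a *: P) = a * conj_diff p A B P.
Proof. by rewrite /conj_diff !mevalZ mulrBr. Qed.

(** After [k] derivatives a form of degree [k + 2] has become a quadratic form S,
    and D S = X^p S_X + Y^p S_Y takes at a point and at its conjugate the same
    value, namely twice the polar form of S at the pair. *)
Lemma conj_diff_Dop p k A B P : p \in [pchar L] ->
    A ^+ (p ^ 2) = A -> B ^+ (p ^ 2) = B -> P \is (k.+2).-homog ->
  conj_diff p A B (iter k (nabla A B) (Dop p P)) = 0.
Proof.
move=> pL Ap Bp; move: P; apply: homog_ind => [|a P Q hP hQ|i j ij].
- by rewrite !linear0 /conj_diff !meval0 subrr.
- by rewrite !linearP /= conj_diffD conj_diffZ hP hQ mulr0 addr0.
elim: k i j ij => [|k IH] i j ij.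
  (* S is one of the monomials X^2, XY, Y^2 *)
  have {}Ap : (A ^+ p) ^+ p = A by rewrite -exprM mulnn.
  have {}Bp : (B ^+ p) ^+ p = B by rewrite -exprM mulnn.
  rewrite /= Dop_mon /conj_diff !mevalD !mevalZ !meval_mon.
  have {ij} : (i, j) \in [:: (2, 0); (1, 1); (0, 2)]%N.
    by rewrite !inE !xpair_eqE; lia.
  rewrite !inE => /or3P[]/eqP[-> ->] /=;
    rewrite ?add1n ?add0n ?exprS ?expr0 ?Ap ?Bp;
    move: (A ^+ p) (B ^+ p) => a b; ring.
rewrite iter_nabla_Dop // iter_nabla_mon.
rewrite linearD !linearZ /= -!iter_nabla_Dop // conj_diffD !conj_diffZ.
have -> : A * i%:R * conj_diff p A B (iter k (nabla A B) (Dop p (mon i.-1 j))) = 0.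
  case: i ij => [|i] ij; first by rewrite mulr0 mul0r.
  by rewrite IH ?mulr0 //; lia.
rewrite add0r; case: j ij => [|j] ij; first by rewrite mulr0 mul0r.
by rewrite IH ?mulr0 //; lia.
Qed.
End BinaryForms.

(** * Equivariance of psi under the group and the torus *)

Section Psi.
Variables (p : nat) (p_pr : prime p).
Variables (L : finFieldType) (cardL : #|L| = (p ^ 2)%N).
Variables (iota : {rmorphism 'F_p -> L}) (alpha : L).
Local Notation GL2 := {'GL_2['F_p]}.
Implicit Types (g h t : GL2) (P Q : {mpoly L[2]}).

(** The entries of the row vector (1, alpha) g: [point 0 g] and [point 1 g] are
    the constants A and B of the formula for psi. *)
Definition point (j : 'I_2) g : L :=
  iota (GLval g 0 j) + iota (GLval g 1 j) * alpha.

Lemma psiE r P Q g :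
  psi iota alpha r P Q g =
    conj_diff p (point 0 g) (point 1 g)
      (iter (r - 2) (nabla (point 0 g) (point 1 g)) P)
    * Q.@[tnth [tuple point 0 g ^+ p; point 1 g ^+ p]].
Proof. by []. Qed.

Lemma pchar_ext : p \in [pchar L].
Proof. by rewrite (fmorph_pchar iota) pchar_Fp. Qed.

Lemma expr_card (x : L) : x ^+ (p ^ 2) = x.
Proof. by rewrite -cardL expf_card. Qed.

Lemma exprpp (x : L) : (x ^+ p) ^+ p = x.
Proof. by rewrite -exprM mulnn expr_card. Qed.

Lemma exprpD (x y : L) : (x + y) ^+ p = x ^+ p + y ^+ p.
Proof. by rewrite -!(pFrobenius_autE pchar_ext) rmorphD. Qed.

Lemma pointM h g j :
  point j (h * g)%g =
    point 0 h * iota (GLval g 0 j) + point 1 h * iota (GLval g 1 j).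
Proof.
by rewrite /point GL_MxE !mxE !sum2 !rmorphD !rmorphM /=; ring.
Qed.

(** Chain rule.  Both sides are derivations along the substitution, so it is
    enough to compare them on the two variables. *)
Lemma nabla_comp (A B : L) g P :
  nabla A B (P \mPo sym_subst iota g) =
    nabla (A * iota (GLval g 0 0) + B * iota (GLval g 1 0))
          (A * iota (GLval g 0 1) + B * iota (GLval g 1 1)) P
    \mPo sym_subst iota g.
Proof.
pose s := sym_subst iota g.
pose A' := A * iota (GLval g 0 0) + B * iota (GLval g 1 0).
pose B' := A * iota (GLval g 0 1) + B * iota (GLval g 1 1).
pose good Q := nabla A B (Q \mPo s) = nabla A' B' Q \mPo s.
have nabla1 a b : nabla a b (1 : {mpoly L[2]}) = 0.
  have := nablaM a b 1 1; rewrite !mulr1 mul1r => /(canLR (addrK _)).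
  by rewrite subrr.
have good1 : good 1 by rewrite /good rmorph1 !nabla1 rmorph0.
have goodM Q1 Q2 : good Q1 -> good Q2 -> good (Q1 * Q2).
  rewrite /good => h1 h2; rewrite rmorphM /= !nablaM h1 h2.
  by rewrite [RHS]comp_mpolyD; congr (_ + _); rewrite [RHS]rmorphM.
have goodX j : good 'X_j.
  rewrite /good nablaX comp_mpolyXU -tnth_nth sym_subst_X comp_mpolyC sum2.
  rewrite linearD !linearZ /= !nablaX -!mul_mpolyC -!mpolyCM -mpolyCD.
  by congr _%:MP; rewrite ![_ * tnth _ _]mulrC; elim/ord2_ind: j.
have goodD Q1 Q2 : good Q1 -> good Q2 -> good (Q1 + Q2).
  by rewrite /good => h1 h2; rewrite comp_mpolyD !nablaD h1 h2 [RHS]comp_mpolyD.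
have goodZ a Q : good Q -> good (a *: Q).
  by rewrite /good => h; rewrite comp_mpolyZ !nablaZ h comp_mpolyZ.
rewrite -/(good P) [P]mpolyE; elim/big_ind: _ => //.
  by rewrite -(scale0r 1); exact: goodZ.
move=> m _; apply: goodZ.
rewrite mpolyXE_id; elim/big_ind: _ => // j _.
by elim: (m j) => [|k IH]; rewrite ?expr0 // exprS; apply: goodM.
Qed.

Lemma iter_nabla_comp k (A B : L) g P :
  iter k (nabla A B) (P \mPo sym_subst iota g) =
    iter k (nabla (A * iota (GLval g 0 0) + B * iota (GLval g 1 0))
                  (A * iota (GLval g 0 1) + B * iota (GLval g 1 1))) P
    \mPo sym_subst iota g.
Proof. by elim: k => // k IH; rewrite !iterS IH nabla_comp. Qed.

Lemma meval_sym_subst g (x y : L) P :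
  (P \mPo sym_subst iota g).@[tnth [tuple x; y]] =
    P.@[tnth [tuple x * iota (GLval g 0 0) + y * iota (GLval g 1 0);
                    x * iota (GLval g 0 1) + y * iota (GLval g 1 1)]].
Proof.
rewrite comp_mpoly_meval; apply: meval_eq; apply: ord2_ind;
  by rewrite /= mevalD !mevalZ !mevalXU ![iota _ * _]mulrC.
Qed.

Lemma psi_equivariant r P Q g h :
  psi iota alpha r (P \mPo sym_subst iota g) (Q \mPo sym_subst iota g) h
  = psi iota alpha r P Q (h * g)%g.
Proof.
rewrite !psiE /conj_diff iter_nabla_comp !meval_sym_subst !pointM.
have E (a b : 'F_p) (x y : L) :
    (x * iota a + y * iota b) ^+ p = x ^+ p * iota a + y ^+ p * iota b.
  by rewrite exprpD !exprMn !(iotaXp iota p_pr).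
by rewrite !E.
Qed.

(** The row (1, alpha) is an eigenvector of [t] with eigenvalue
    l = [omega2 iota alpha t], so [t] scales (A, B) by l.  The factor involving
    P is then multiplied by l^(r-2) l^(p+1), the same at the two conjugate
    points because (l^p)^(p+1) = l^(p+1), and the factor involving Q by
    (l^p)^(p-1). *)
Lemma psi_torus r P Q t g : (2 <= r)%N ->
    P \is (r + p - 1).-homog -> Q \is (p - 1).-homog -> t \in torus iota alpha ->
  psi iota alpha r P Q (t * g)%g = omega2 iota alpha t ^+ r * psi iota alpha r P Q g.
Proof.
move=> r2 hP hQ; rewrite inE.
move=> /existsP[u /existsP[v /and4P[/eqP E1 /eqP E2 /eqP E3 /eqP E4]]].
set l := omega2 iota alpha t.
have pt j : point j (t * g)%g = l * point j g.
  rewrite pointM /point /l /omega2 E2 E3 E4 E1; ring.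
have p0 := prime_gt0 p_pr.
have hP' : P \is (p + 1 + (r - 2)).-homog.
  by have -> : (p + 1 + (r - 2) = r + p - 1)%N by lia.
have hQ' : Q \is (p - 1 + 0).-homog by rewrite addn0.
rewrite !psiE !pt /conj_diff !exprMn !(iter_nabla_homothety _ _ _ _ _ _ hP').
(* Q is not differentiated: the order and the direction are dummies *)
rewrite [Q.@[_]](iter_nabla_homothety 0 0 _ _ 0 _ hQ') /= expr0 mul1r.
have -> : l ^+ r = l ^+ (r - 2) * (l * l) by rewrite -expr2 -exprD subnK.
have -> : l * l = l * (l ^+ p * (l ^+ p) ^+ (p - 1)).
  by rewrite -exprS subn1 prednK // exprpp.
by rewrite !addn1 !exprS exprpp; ring.
Qed.

End Psi.

(** * Cosets of the torus *)

Section Cosets.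
Variables (p : nat) (p_pr : prime p).
Variables (L : finFieldType) (cardL : #|L| = (p ^ 2)%N).
Variables (iota : {rmorphism 'F_p -> L}) (alpha : L).
Hypothesis alphaNFp : alpha \notin codom iota.
Hypothesis alpha2Fp : alpha ^+ 2 \in codom iota.
Local Notation GL2 := {'GL_2['F_p]}.
Implicit Types (g h t : GL2).
Local Notation point := (point iota alpha).

Lemma coord_inj (u v u' v' : 'F_p) :
  iota u + iota v * alpha = iota u' + iota v' * alpha -> u = u' /\ v = v'.
Proof.
move=> E; have E' : iota (v - v') * alpha = iota (u' - u).
  by rewrite !rmorphB mulrBl; apply/eqP; rewrite subr_eq addrAC -E addrC addKr.
have [/eqP|nv] := eqVneq (v - v') 0; last first.
  case/negP: alphaNFp; apply/codomP; exists ((u' - u) / (v - v')).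
  by rewrite fmorph_div -E' mulrC mulKf // fmorph_eq0.
rewrite subr_eq0 => /eqP vv; split=> //.
by apply: (fmorph_inj iota); move: E; rewrite vv => /addIr.
Qed.

Lemma coord_surj (x : L) : exists u v, x = iota u + iota v * alpha.
Proof.
pose f (uv : 'F_p * 'F_p) := iota uv.1 + iota uv.2 * alpha.
have fI : injective f by move=> [u v] [u' v'] /coord_inj /= [-> ->].
have /codomP[[u v] ->] : x \in codom f.
  by apply: inj_card_onto; rewrite // card_prod card_Fp // cardL mulnn.
by exists u, v.
Qed.

Lemma point_inj g h : (forall j, point j g = point j h) -> g = h.
Proof.
move=> E; apply/val_inj/matrixP => i j; have [E0 E1] := coord_inj (E j).
by elim/ord2_ind: i.
Qed.

(** A and B are linearly independent over the prime field: (A, B) g^-1 is the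
    row (1, alpha), so a common scalar [c] would put alpha in the prime
    field. *)
Lemma point_independent g c a b :
  point 0 g = c * iota a -> point 1 g = c * iota b -> False.
Proof.
move=> E0 E1.
have E j : point j 1%g = c * iota (a * GLval g^-1%g 0 j + b * GLval g^-1%g 1 j).
  by rewrite -(mulgV g) pointM E0 E1 rmorphD !rmorphM mulrDr !mulrA.
have p0 : point 0 1%g = 1.
  by rewrite /point GL_1E !mxE /= rmorph1 rmorph0 mul0r addr0.
have p1 : point 1 1%g = alpha.
  by rewrite /point GL_1E !mxE /= rmorph1 rmorph0 mul1r add0r.
have := E 0; have := E 1; rewrite p0 p1.
move: (_ + _) => d; move: (_ + _) => e Ea E1'.
have e0 : iota e != 0.
  by apply/eqP=> e0; move/eqP: E1'; rewrite e0 mulr0 oner_eq0.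
case/negP: alphaNFp; apply/codomP; exists (d / e).
by rewrite fmorph_div Ea -[c](mulfK e0) -E1' mul1r mulrC.
Qed.

Lemma point1_neq0 g : point 1 g != 0.
Proof.
apply/eqP => E; apply: (@point_independent g (point 0 g) 1 0).
  by rewrite rmorph1 mulr1.
by rewrite rmorph0 mulr0.
Qed.

Lemma point_ratio g : point 0 g / point 1 g \notin codom iota.
Proof.
apply/negP => /codomP[x E]; apply: (@point_independent g (point 1 g) x 1).
  by rewrite -E mulrC divfK // point1_neq0.
by rewrite rmorph1 mulr1.
Qed.

Lemma point_exists z : z \notin codom iota ->
  exists g, point 0 g = z /\ point 1 g = 1.
Proof.
have [a [c ->]] := coord_surj z => zN.
pose M : 'M['F_p]_2 := \matrix_(i, j)
  if i == 0 then (if j == 0 then a else 1) else (if j == 0 then c else 0).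
have Mu : M \in unitmx.
  rewrite unitmxE unitfE det2 !mxE /= mulr0 sub0r mul1r oppr_eq0.
  apply: contraNneq zN => ->; rewrite rmorph0 mul0r addr0; exact: codom_f.
exists (Sub M Mu : GL2); rewrite /point SubK !mxE /=.
by rewrite rmorph0 rmorph1 mul0r addr0.
Qed.

(** The torus element is the one with eigenvalue B = [point 1 g] on (1, alpha):
    it carries the normalised row (A / B, 1) to (A, B), and the row determines
    the matrix. *)
Lemma torus_coset g h : point 1 h = 1 -> point 0 h = point 0 g / point 1 g ->
  exists2 t, t \in torus iota alpha & g = (t * h)%g.
Proof.
move=> h1 h0; have [u [v E]] := coord_surj (point 1 g).
have uv0 : (u, v) != (0, 0).
  apply: contraTneq (point1_neq0 g) => -[u0 v0].
  by rewrite E u0 v0 rmorph0 mul0r addr0 eqxx.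
have [t tT /and4P[/eqP E1 /eqP E2 /eqP E3 /eqP E4]] :=
  torus_elt_exists alphaNFp alpha2Fp uv0.
exists t => //; apply: point_inj => j.
have -> : point j (t * h)%g = point 1 g * point j h.
  by rewrite pointM E /point E2 E1 E3 E4; ring.
elim/ord2_ind: j; first by rewrite h0 mulrC divfK // point1_neq0.
by rewrite h1 mulr1.
Qed.

Lemma ind_ext (chi : GL2 -> L) (f1 f2 : ind (torus iota alpha) chi) :
  (forall g, point 1 g = 1 -> f1 g = f2 g) -> f1 = f2.
Proof.
move=> E; apply/val_inj/ffunP => g.
have [h [h0 h1]] := point_exists (point_ratio g).
have [t tT ->] := torus_coset h1 h0.
by rewrite !ind_equivariant // E.
Qed.
End Cosets.

(** * The map on the tensor product *)

Section Map.
Variables (p : nat) (p_pr : prime p).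
Variables (L : finFieldType) (cardL : #|L| = (p ^ 2)%N).
Variables (iota : {rmorphism 'F_p -> L}) (alpha : L).
Variables (r : nat) (r_ge2 : (2 <= r)%N).
Local Notation GL2 := {'GL_2['F_p]}.
Local Notation V := (Vsym L).
Local Notation W := (DV p L r).
Local Notation chi := (fun t => omega2 iota alpha t ^+ r).
Local Notation Ind_T := (ind (torus iota alpha) chi).
Local Notation psi := (psi iota alpha r).

Lemma psi_linearl (Q : {mpoly L[2]}) g : linear (fun P => psi P Q g : L^o).
Proof.
move=> a P P'; rewrite !psiE linearD linearZ /= conj_diffD conj_diffZ mulrDl.
by rewrite -mulrA.
Qed.

Lemma psi_linearr (P : {mpoly L[2]}) g : linear (fun Q => psi P Q g : L^o).
Proof.
move=> a Q Q'; rewrite !psiE mevalD mevalZ mulrDr.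
by congr (_ + _); rewrite mulrCA.
Qed.

Lemma psi_DV (P P' : V (r + p - 1)) Q g : vproj W P = vproj W P' ->
  psi P Q g = psi P' Q g.
Proof.
move/vprojP => /memv_imgP[R _]; rewrite lfunE /= => E.
have -> : (P : {mpoly L[2]}) = Dop p R + P'.
  by rewrite -[Dop p R]/(val (Dmap p R)) -E /= subrK.
rewrite !psiE linearD /= conj_diffD conj_diff_Dop ?add0r //.
- exact: pchar_ext.
- exact: expr_card.
- exact: expr_card.
have -> : ((r - 2).+2 = r)%N by lia.
by case: R {E}.
Qed.

Lemma psi_ind_subproof (P : V (r + p - 1)) (Q : V (p - 1)) :
  [ffun g => psi P Q g : L^o] \in ind_pred (torus iota alpha) chi.
Proof.
apply/ind_predP => t g tT; rewrite !ffunE psi_torus //.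
  by case: P.
by case: Q.
Qed.

Definition psi_ind P Q : Ind_T := Ind (psi_ind_subproof P Q).

Lemma psi_indE P Q g : psi_ind P Q g = psi P Q g.
Proof. by rewrite ffunE. Qed.

(** [vlift] picks some representative of the class; by [psi_DV] the choice does
    not matter. *)
Definition psi_quot (x : Vquot p L r) Q : Ind_T := psi_ind (vlift x) Q.

Lemma psi_quotE P Q g : psi_quot (vproj W P) Q g = psi P Q g.
Proof. by rewrite psi_indE; apply: psi_DV; rewrite vliftK. Qed.

Lemma psi_quot_bilinear : bilinear_map psi_quot.
Proof.
split=> [x|Q] a y z; apply/val_inj/ffunP => g;
  rewrite [RHS]ffunE [X in _ = X + _]ffunE.
  by rewrite !psi_indE; exact: psi_linearr.
rewrite -(vliftK y) -(vliftK z) -[X in psi_quot X](linearP (vproj W)) /=.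
by rewrite !psi_quotE; exact: psi_linearl.
Qed.

Definition psi_tensor : tensor (Vquot p L r) (V (p - 1)) -> Ind_T :=
  tensor_lift psi_quot.

Lemma psi_tensor_linear : linear psi_tensor.
Proof. exact: tensor_lift_linear. Qed.

Lemma psi_tensor_pure P Q g : psi_tensor (pure (vproj W P) Q) g = psi P Q g.
Proof.
by rewrite /psi_tensor tensor_lift_pure ?psi_quotE //; exact: psi_quot_bilinear.
Qed.

Lemma psi_tensor_equivariant g x :
  psi_tensor (tensor_rep (Vquot_rep iota p_pr r) (Vsym_rep iota (p - 1)) g x)
  = ind_rep (torus iota alpha) chi g (psi_tensor x).
Proof.
apply: (tensor_ext
  (f1 := fun x => psi_tensor (tensor_rep (Vquot_rep iota p_pr r) (Vsym_rep iota (p - 1)) g x))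
  (f2 := fun x => ind_rep (torus iota alpha) chi g (psi_tensor x))).
- by move=> a y z; rewrite rep_linear psi_tensor_linear.
- by move=> a y z; rewrite psi_tensor_linear rep_linear.
move=> y Q; rewrite -(vliftK y) /= tensor_act_pure /= quot_act_proj; last first.
  by move=> k v; exact: DV_stable.
apply/val_inj/ffunP => h; rewrite [RHS]ffunE !psi_tensor_pure.
exact: psi_equivariant.
Qed.
End Map.

(** * Values on monomials as polynomials in one variable *)

Section Poly.
Variables (L : fieldType) (p : nat).

Lemma natr_fact_neq0 n : p \in [pchar L] -> (n < p)%N -> (n`!)%:R != 0 :> L.
Proof.
move=> pL; elim: n => [|n IH] np; first by rewrite oner_eq0.
rewrite factS natrM mulf_neq0 ?IH 1?ltnW //.
by rewrite -(dvdn_pcharf pL) gtnNdvd.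
Qed.

Lemma natr_ffactDp n k : p \in [pchar L] ->
  ((p + n) ^_ k)%:R = (n ^_ k)%:R :> L.
Proof.
move=> pL; elim: k n => [|k IH] [|n] //.
  by rewrite addn0 ffact0n ffactnS natrM (pcharf0 pL) mul0r.
by rewrite addnS !ffactSS !natrM IH -addnS natrD (pcharf0 pL) add0r.
Qed.

(** Euler's identity: differentiating a form along the point where it is then
    evaluated only multiplies its value by a falling factorial of the degree. *)
Lemma iter_nabla_Euler k i j (A B : L) :
  (iter k (nabla A B) (mon L i j)).@[tnth [tuple A; B]]
  = ((i + j) ^_ k)%:R * (A ^+ i * B ^+ j).
Proof.
elim: k i j => [|k IH] i j; first by rewrite meval_mon mul1r.
rewrite iter_nabla_mon mevalD !mevalZ !IH.
case: i j => [|i] [|j] /=.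
- by rewrite !mulr0 !mul0r addr0.
- by rewrite !add0n ffactSS natrM !exprS; ring.
- by rewrite !addn0 ffactSS natrM !exprS; ring.
- have -> : (i + j.+1 = i.+1 + j)%N by lia.
  by rewrite addnS ffactSS natrM -addnS natrD !exprS; ring.
Qed.

(** The value at (w, 1) of the [k]-th derivative of X^i Y^j in the direction
    (w^p, 1), with w replaced by the variable; the recursion is that of
    [iter_nabla_mon]. *)
Fixpoint nabla_poly k i j : {poly L} :=
  if k is k'.+1 then
    i%:R *: ('X^p * nabla_poly k' i.-1 j) + j%:R *: nabla_poly k' i j.-1
  else 'X^i.

Lemma horner_nabla_poly k i j w :
  (nabla_poly k i j).[w] =
  (iter k (nabla (w ^+ p) 1) (mon L i j)).@[tnth [tuple w; 1]].
Proof.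
elim: k i j => [|k IH] i j; first by rewrite meval_mon hornerXn expr1n mulr1.
rewrite iter_nabla_mon mevalD !mevalZ -!IH /=.
by rewrite hornerD !hornerZ hornerM hornerXn; ring.
Qed.

Hypothesis p_gt1 : (1 < p)%N.

Lemma size_nabla_poly k i j : (size (nabla_poly k i j) <= (p * i).+1)%N.
Proof.
elim: k i j => [|k IH] i j /=; first by rewrite size_polyXn ltnS leq_pmull // ltnW.
apply: (leq_trans (size_polyD _ _)); rewrite geq_max; apply/andP; split.
  case: i => [|i]; first by rewrite scale0r size_poly0.
  apply: (leq_trans (size_scale_leq _ _)).
  apply: (leq_trans (size_polyMleq _ _)).
  by rewrite size_polyXn /=; have := IH i j; move: (size _) => s; lia.
exact: (leq_trans (size_scale_leq _ _)).
Qed.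

(** The exponent [p * i] is reached only when X^i is differentiated exactly [i]
    times along X, each time producing a factor w^p. *)
Lemma coef_nabla_poly k i j :
  (nabla_poly k i j)`_(p * i) = (k ^_ i * j ^_ (k - i))%:R.
Proof.
elim: k i j => [|k IH] i j.
  rewrite /= coefXn ffact0n sub0n ffactn0 muln1.
  by congr ((nat_of_bool _)%:R); apply/idP/idP; nia.
rewrite /= coefD !coefZ coefXnM; case: i => [|i] /=.
  by rewrite mul0r add0r IH !ffactn0 !mul1n !subn0 ffactnS natrM.
have -> : (p * i.+1 < p)%N = false by nia.
have -> : (p * i.+1 - p = p * i)%N by nia.
rewrite !IH -!natrM -natrD; congr (_%:R).
rewrite ffactSS subSS.
have [ki|ki] := leqP k i; last first.
  have [d kE] : exists d, k = (i + d.+1)%N by exists (k - i.+1)%N; lia.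
  have -> : (k - i.+1 = d)%N by lia.
  rewrite [k ^_ i.+1]ffactnSr; have -> : (k - i = d.+1)%N by lia.
  by rewrite ffactnS; move: (k ^_ i) (j.-1 ^_ d) => x y; rewrite kE; ring.
rewrite [k ^_ i.+1]ffact_small // mul0n muln0 addn0.
have [->|nki] := eqVneq k i; first by lia.
by rewrite ffact_small; lia.
Qed.

(** The factor of psi that involves P = X^i Y^j, at A = w^p and B = 1; then
    A^p = w for w in the field with p^2 elements, and the subtracted term is
    the value at (A, B) given by Euler's identity. *)
Definition psi_poly k i j : {poly L} :=
  nabla_poly k i j - ((i + j) ^_ k)%:R *: 'X^(p * i).

Lemma horner_psi_poly k i j w : w ^+ (p ^ 2) = w ->
  (psi_poly k i j).[w] =
    conj_diff p (w ^+ p) 1 (iter k (nabla (w ^+ p) 1) (mon L i j)).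
Proof.
move=> wp; rewrite /conj_diff -exprM mulnn wp expr1n.
rewrite iter_nabla_Euler -horner_nabla_poly expr1n mulr1 -exprM.
by rewrite hornerD hornerN hornerZ hornerXn.
Qed.

(** With k = r - 2, the coefficient is k^_i (m - i)^_(k - i) - m^_k for
    m = r + p - 1.  Modulo p one may drop p from m and from m - i, which gives
    k! (k + 1 - i) - (k + 1)! = - k! i if i <= k, and - (k + 1)! if i > k. *)
Lemma coef_psi_poly r i : p \in [pchar L] -> (2 <= r < p)%N -> (0 < i < p)%N ->
  (psi_poly (r - 2) i (r + p - 1 - i))`_(p * i) != 0.
Proof.
move=> pL rp ip; have [k rE] : exists k, r = k.+2 by exists (r - 2)%N; lia.
rewrite {r}rE in rp *; rewrite -[k.+2]addn2 addnK.
rewrite coefB coefZ coefXn eqxx mulr1 coef_nabla_poly.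
have -> : (i + (k + 2 + p - 1 - i) = p + k.+1)%N by lia.
rewrite (natr_ffactDp k.+1 k pL).
have -> : (k.+1 ^_ k = k.+1`!)%N.
  by have := ffact_fact (leqnSn k); rewrite subSnn muln1.
have [ik|ki] := leqP i k; last first.
  by rewrite ffact_small // mul0n sub0r oppr_eq0 natr_fact_neq0 //; lia.
have -> : (k + 2 + p - 1 - i = p + (k - i).+1)%N by lia.
rewrite natrM natr_ffactDp // -natrM.
have -> : ((k - i).+1 ^_ (k - i) = (k - i).+1`!)%N.
  by have := ffact_fact (leqnSn (k - i)); rewrite subSnn muln1.
have E : (k ^_ i * (k - i).+1`! + k`! * i = k.+1`!)%N.
  rewrite !factS -(ffact_fact ik); have -> : (k.+1 = (k - i).+1 + i)%N by lia.
  by move: (k ^_ i)%N ((k - i)`!) (k - i)%N => x y z; ring.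
rewrite -E natrD opprD addrA subrr sub0r oppr_eq0 natrM mulf_neq0 //.
  by apply: natr_fact_neq0 => //; lia.
by rewrite -(dvdn_pcharf pL) gtnNdvd //; lia.
Qed.

Lemma size_psi_poly r i : p \in [pchar L] -> (2 <= r < p)%N -> (0 < i < p)%N ->
  size (psi_poly (r - 2) i (r + p - 1 - i)) = (p * i).+1.
Proof.
move=> pL rp ip; apply/eqP; rewrite eqn_leq; apply/andP; split.
  apply: (leq_trans (size_polyD _ _)); rewrite geq_max size_nabla_poly size_polyN.
  by apply: (leq_trans (size_scale_leq _ _)); rewrite size_polyXn.
rewrite ltnNge; apply: contra (coef_psi_poly pL rp ip) => h.
by rewrite nth_default.
Qed.

End Poly.

(** The summand of largest degree with nonzero coefficient cannot be
    cancelled. *)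
Lemma size_inj_free (L : fieldType) (I : finType) (F : I -> {poly L}) (c : I -> L) :
    (forall i, F i != 0) -> injective (fun i => size (F i)) ->
  \sum_i c i *: F i = 0 -> forall i, c i = 0.
Proof.
move=> F0 Finj sum0 i; apply/eqP; apply: contraT => ci.
pose i0 := [arg max_(j > i | c j != 0) size (F j)].
have [ci0 max_i0] : c i0 != 0 /\ forall j, c j != 0 -> (size (F j) <= size (F i0))%N.
  by rewrite /i0; case: arg_maxnP.
have /eqP := congr1 (fun q : {poly L} => q`_(size (F i0)).-1) sum0.
rewrite coef0 coef_sum (bigD1 i0) //= coefZ big1 ?addr0 => [|j ji0].
  by rewrite mulf_eq0 (negbTE ci0) /= -lead_coefE lead_coef_eq0 (negbTE (F0 i0)).
rewrite coefZ; have [->|cj] := eqVneq (c j) 0; first by rewrite mul0r.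
rewrite [_`__]nth_default ?mulr0 //.
have := max_i0 _ cj; rewrite leq_eqVlt => /orP[/eqP/Finj ji|].
  by rewrite ji eqxx in ji0.
by move: (size (F j)) (size (F i0)) => a b; lia.
Qed.

Lemma finField_poly_eq0 (L : finFieldType) (q : {poly L}) :
  (size q <= #|L|)%N -> (forall w, q.[w] = 0) -> q = 0.
Proof.
move=> sq q0; apply: (roots_geq_poly_eq0 (rs := enum L)).
- by apply/allP => w _; apply/rootP.
- exact: enum_uniq.
- by rewrite -cardE.
Qed.

(** * Generators of the tensor product *)

Section Span.
Variables (L : fieldType) (p : nat).

(** The monomial X^i Y^(n-i) as a form of degree [n]; zero when [i > n]. *)
Definition form n i : Vsym L n := insubd 0 (mon L i (n - i)).

Lemma val_form n i : (i <= n)%N -> (form n i : {mpoly L[2]}) = mon L i (n - i).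
Proof. by move=> le_in; rewrite insubdK // -{2}(subnKC le_in) mon_homog. Qed.

Lemma form_span n (Q : Vsym L n) :
  exists c : 'I_n.+1 -> L, Q = \sum_j c j *: form n j.
Proof.
have [c E] : exists c : 'I_n.+1 -> L,
    (Q : {mpoly L[2]}) = \sum_(j < n.+1) c j *: mon L j (n - j).
  case: Q => Q hQ /=; move: Q hQ.
  apply: homog_ind => [|a P Q [c ->] [d ->]|i j ij].
  - by exists (fun=> 0); rewrite big1 // => i _; rewrite scale0r.
  - exists (fun j => a * c j + d j); rewrite scaler_sumr -big_split /=.
    by apply: eq_bigr => j _; rewrite scalerA scalerDl.
  have lt_in : (i < n.+1)%N by lia.
  exists (fun k => (k == Ordinal lt_in)%:R); rewrite (bigD1 (Ordinal lt_in)) //=.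
  rewrite eqxx scale1r big1 ?addr0 => [|k /negbTE->]; last by rewrite scale0r.
  by congr (mon _ _ _); lia.
exists c; apply/val_inj; rewrite raddf_sum [LHS]E; apply: eq_bigr => j _.
by rewrite /= val_form // -ltnS.
Qed.

(** D(X^t Y^(r-t)) = t X^(t-1+p) Y^(r-t) + (r-t) X^t Y^(r-t-1+p), and
    0 < t <= r < p makes [t] invertible: monomials whose X-exponent is at least
    p can be lowered by p - 1, and for t = 0 the power of Y alone is itself in
    the image of D. *)
Lemma homog_mod_Dop r P : p \in [pchar L] -> (2 <= r < p)%N ->
    P \is (r + p - 1).-homog ->
  exists (c : 'I_(p - 1) -> L) (R : {mpoly L[2]}),
    R \is r.-homog /\
    P = \sum_(i < p - 1) c i *: mon L i.+1 (r + p - 1 - i.+1) + Dop p R.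
Proof.
move=> pL rp.
have natr_neq0 n : (0 < n < p)%N -> n%:R != 0 :> L.
  by move=> np; rewrite -(dvdn_pcharf pL) gtnNdvd //; lia.
have delta t (x : L) : (0 < t < p)%N ->
    \sum_(i < p - 1) (if i.+1 == t then x else 0) *: mon L i.+1 (r + p - 1 - i.+1)
    = x *: mon L t (r + p - 1 - t).
  move=> tp; have lt_t : (t.-1 < p - 1)%N by lia.
  rewrite (bigD1 (Ordinal lt_t)) //= prednK ?eqxx; last by lia.
  rewrite big1 ?addr0 // => i ni; case: eqP => [E|_]; last by rewrite scale0r.
  by case/eqP: ni; apply/val_inj => /=; lia.
move: P; apply: homog_ind => [|a P Q [c [R [hR ->]]] [d [S [hS ->]]]|i j ij].
- exists (fun=> 0), 0; split; first exact: dhomog0.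
  by rewrite linear0 addr0 big1 // => i _; rewrite scale0r.
- exists (fun j => a * c j + d j), (a *: R + S); split.
    by rewrite rpredD // rpredZ.
  rewrite DopD DopZ scalerDr scaler_sumr addrACA -big_split /=; congr (_ + _).
  by apply: eq_bigr => j _; rewrite scalerA scalerDl.
have [i0|i_gt0] := posnP i.
  exists (fun=> 0), (r%:R^-1 *: mon L 0 r); split.
    by rewrite rpredZ //; exact: (mon_homog _ 0 r).
  rewrite big1 ?add0r => [|k _]; last by rewrite scale0r.
  rewrite DopZ Dop_mon scale0r add0r scalerA mulVf ?scale1r.
    by rewrite i0; congr (mon _ _ _); lia.
  by apply: natr_neq0; lia.
have [ip|pi] := ltnP i p.
  exists (fun k => if k.+1 == i then 1 else 0), 0; split; first exact: dhomog0.
  rewrite linear0 addr0 delta ?i_gt0 // scale1r.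
  by congr (mon _ _ _); lia.
(* i is the larger X-exponent in D(X^t' Y^(r-t')), with t' = t.+1 *)
have [t iE] : exists t, i = (t.+1.-1 + p)%N by exists (i - p)%N; lia.
exists (fun k => if k.+1 == t.+1 then - (j%:R / t.+1%:R) else 0).
exists (t.+1%:R^-1 *: mon L t.+1 j); split.
  by rewrite rpredZ // (_ : r = t.+1 + j)%N ?mon_homog //; lia.
rewrite delta; last by lia.
have t0 : t.+1%:R != 0 :> L by apply: natr_neq0; lia.
rewrite DopZ Dop_mon scalerDr !scalerA mulVf // scale1r -iE addrCA scaleNr.
have [j0|j0] := posnP j.
  by rewrite j0 mulr0 mul0r !scale0r oppr0 !addr0.
have -> : (r + p - 1 - t.+1 = j.-1 + p)%N by lia.
by rewrite [_^-1 * _]mulrC addNr addr0.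
Qed.
End Span.

(** * Bijectivity *)

Section Bij.
Variables (p : nat) (p_pr : prime p).
Variables (L : finFieldType) (cardL : #|L| = (p ^ 2)%N).
Variables (iota : {rmorphism 'F_p -> L}) (alpha : L).
Hypothesis alphaNFp : alpha \notin codom iota.
Hypothesis alpha2Fp : alpha ^+ 2 \in codom iota.
Variables (r : nat) (r_ge2 : (2 <= r)%N) (r_le : (r <= p - 1)%N).
Local Notation GL2 := {'GL_2['F_p]}.
Local Notation V := (Vsym L).
Local Notation W := (DV p L r).
Local Notation chi := (fun t => omega2 iota alpha t ^+ r).
Local Notation Ind_T := (ind (torus iota alpha) chi).
Local Notation psi_tensor := (psi_tensor p_pr cardL iota alpha r_ge2).
Local Notation point := (point iota alpha).
Local Notation I := ('I_(p - 1) * 'I_(p - 1).+1)%type.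

Definition basis_tensor (ij : I) : tensor (Vquot p L r) (V (p - 1)) :=
  pure (vproj W (form L (r + p - 1) ij.1.+1)) (form L (p - 1) ij.2).

Lemma Vquot_span (x : Vquot p L r) : exists c : 'I_(p - 1) -> L,
  x = \sum_i c i *: vproj W (form L (r + p - 1) i.+1).
Proof.
rewrite -(vliftK x); move: (vlift x) => P.
have [c [R [hR E]]] : exists (c : 'I_(p - 1) -> L) (R : {mpoly L[2]}),
    R \is r.-homog /\
    (P : {mpoly L[2]}) = \sum_(i < p - 1) c i *: mon L i.+1 (r + p - 1 - i.+1) + Dop p R.
  by apply: homog_mod_Dop; [exact: (pchar_ext p_pr iota) | lia | case: (P)].
exists c; rewrite -(linear_fun_sum _ _ (linearP (vproj W))).
apply/vprojP; apply/memv_imgP; exists (DHomog hR); first exact: memvf.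
rewrite lfunE; apply/val_inj => /=; rewrite raddf_sum E /=.
rewrite addrAC -sumrB big1 ?add0r // => i _.
by rewrite val_form ?subrr //; have := ltn_ord i; lia.
Qed.

Lemma tensor_span (x : tensor (Vquot p L r) (V (p - 1))) :
  exists c : {ffun I -> L}, x = \sum_ij c ij *: basis_tensor ij.
Proof.
pose S y := exists c : {ffun I -> L}, y = \sum_ij c ij *: basis_tensor ij.
have S0 : S 0.
  by exists [ffun=> 0]; rewrite big1 // => ij _; rewrite ffunE scale0r.
have SD a y z : S y -> S z -> S (a *: y + z).
  move=> [c ->] [d ->]; exists [ffun ij => a * c ij + d ij].
  rewrite scaler_sumr -big_split /=.
  by apply: eq_bigr => ij _; rewrite ffunE scalerA scalerDl.
have Spure u v : S (pure u v).
  have [c ->] := Vquot_span u; have [d ->] := form_span v.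
  have [lr ll] := @pure_bilinear L (Vquot p L r) (V (p - 1)).
  exists [ffun ij => c ij.1 * d ij.2]; rewrite (linear_fun_sum _ _ (ll _)).
  transitivity (\sum_i \sum_j (c i * d j) *: basis_tensor (i, j)).
    apply: eq_bigr => i _; rewrite (linear_fun_sum _ _ (lr _)) scaler_sumr.
    by apply: eq_bigr => j _; rewrite scalerA.
  by rewrite pair_bigA /=; apply: eq_bigr => -[i j] _; rewrite ffunE.
rewrite -/(S x) (tensorE x) /tensor_lift.
elim/big_ind: _ => // [y z Sy Sz|i _]; first by rewrite -[y]scale1r; exact: SD.
elim/big_ind: _ => // [y z Sy Sz|j _]; first by rewrite -[y]scale1r; exact: SD.
by rewrite -[_ *: _]addr0; apply: SD.
Qed.

Definition basis_poly (ij : I) : {poly L} :=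
  psi_poly L p (r - 2) ij.1.+1 (r + p - 1 - ij.1.+1) * 'X^(ij.2).

Lemma size_basis_poly ij : size (basis_poly ij) = (p * ij.1.+1 + ij.2).+1.
Proof.
case: ij => i j /=; have pL := pchar_ext p_pr iota.
have E : size (psi_poly L p (r - 2) i.+1 (r + p - 1 - i.+1)) = (p * i.+1).+1.
  by apply: size_psi_poly; [exact: prime_gt1 | by [] | lia | have := ltn_ord i; lia].
by rewrite /basis_poly size_mulXn -?size_poly_eq0 E // addnS addnC.
Qed.

Lemma psi_tensor_basis ij g w : point 0 g = w ^+ p -> point 1 g = 1 ->
  psi_tensor (basis_tensor ij) g = (basis_poly ij).[w].
Proof.
case: ij => i j E0 E1; rewrite psi_tensor_pure psiE E0 E1 /=.
rewrite !val_form; [|by have := ltn_ord j; lia|by have := ltn_ord i; lia].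
rewrite -horner_psi_poly ?(expr_card cardL) //.
by rewrite meval_mon !expr1n mulr1 (exprpp cardL) hornerM hornerXn.
Qed.

(** On the prime field a point is its own conjugate. *)
Lemma basis_poly_codom ij w : w \in codom iota -> (basis_poly ij).[w] = 0.
Proof.
move=> /codomP[a ->]; rewrite hornerM horner_psi_poly ?(expr_card cardL) //.
by rewrite /conj_diff !(iotaXp iota p_pr) expr1n subrr mul0r.
Qed.

Lemma psi_tensor_sum (c : {ffun I -> L}) g :
  psi_tensor (\sum_ij c ij *: basis_tensor ij) g
  = \sum_ij c ij * psi_tensor (basis_tensor ij) g.
Proof.
pose ev (x : tensor (Vquot p L r) (V (p - 1))) : L^o := psi_tensor x g.
have ev_linear : linear ev.
  by move=> a x y; rewrite /ev psi_tensor_linear !ffunE.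
exact: (linear_fun_sum c basis_tensor ev_linear).
Qed.

(** The vanishing hypothesis only concerns w outside the prime field, but the
    polynomials vanish on the prime field as well; p^2 zeros exceed the degree,
    and the degrees p (i + 1) + j are base-p expansions, hence distinct. *)
Lemma psi_tensor_free (c : {ffun I -> L}) :
    (forall g, point 1 g = 1 ->
      psi_tensor (\sum_ij c ij *: basis_tensor ij) g = 0) ->
  c = 0.
Proof.
move=> psi0; have q0 : \sum_ij c ij *: basis_poly ij = 0.
  apply: finField_poly_eq0 => [|w].
    rewrite cardL; apply: (leq_trans (size_sum _ _ _)).
    apply/bigmax_leqP => -[i j] _.
    apply: (leq_trans (size_scale_leq _ _)); rewrite size_basis_poly /=.
    by have := ltn_ord i; have := ltn_ord j; nia.
  rewrite horner_sum; have [wF|wNF] := boolP (w \in codom iota).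
    by rewrite big1 // => ij _; rewrite hornerZ basis_poly_codom ?mulr0.
  (* w^p and not w is the A-coordinate, as in the definition of psi_poly *)
  have wpNF : w ^+ p \notin codom iota.
    apply: contra wNF => /codomP[a E].
    by rewrite -(exprpp cardL w) E (iotaXp iota p_pr) codom_f.
  have [g [g0 g1]] := point_exists p_pr cardL alphaNFp wpNF.
  rewrite -[RHS](psi0 g g1) psi_tensor_sum; apply: eq_bigr => ij _.
  by rewrite hornerZ (psi_tensor_basis _ g0 g1).
apply/ffunP => ij; rewrite ffunE; move: ij; apply: size_inj_free q0 => [ij|].
  by rewrite -size_poly_eq0 size_basis_poly.
move=> [i j] [i' j'] /=; rewrite !size_basis_poly /= => -[E].
have p_gt0 := prime_gt0 p_pr.
have lt_p (k : 'I_(p - 1).+1) : (k < p)%N by have := ltn_ord k; lia.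
have Ei : i = i' :> nat.
  have := congr1 (divn^~ p) E.
  by rewrite ![(p * _)%N]mulnC !divnMDl // !divn_small // !addn0 => -[].
have Ej : j = j' :> nat by move: E; rewrite Ei => /addnI.
by congr (_, _); apply/val_inj.
Qed.

(** The elements with B = 1 form a system of representatives of the cosets of
    the torus. *)
Local Notation chart := {g : GL2 | point 1 g == 1}.

Lemma card_chart : (#|{: chart}| <= #|{: I}|)%N.
Proof.
rewrite card_prod !card_ord.
have -> : ((p - 1) * (p - 1).+1 = #|[predC codom iota]|)%N.
  have := cardC (mem (codom iota)).
  rewrite card_codom ?card_Fp //; last exact: fmorph_inj.
  rewrite cardL -mulnn => E; have := prime_gt1 p_pr.
  by move: #|_| E => n E; nia.
pose ratio (g : chart) := point 0 (val g).
have ratio_inj : injective ratio.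
  move=> [g g1] [h h1]; rewrite /ratio /= => E; apply/val_inj => /=.
  apply: (point_inj alphaNFp); apply: ord2_ind => //.
  by rewrite (eqP g1) (eqP h1).
rewrite -(card_codom ratio_inj); apply: subset_leq_card; apply/subsetP => z.
case/codomP => -[g /= g1] ->; rewrite inE /ratio /=.
by have := point_ratio alphaNFp g; rewrite (eqP g1) divr1.
Qed.

(** With E the map from coefficient families to combinations of the spanning
    tensors and [ev] the restriction to representatives, [ev \o psi_tensor \o E]
    is injective between finite sets of which the second is not larger, hence
    bijective; [ev] being injective and E surjective, psi_tensor is bijective. *)
Lemma psi_tensor_bij : bijective psi_tensor.
Proof.
pose E (c : {ffun I -> L}) := \sum_ij c ij *: basis_tensor ij.
pose ev (f : Ind_T) := [ffun g : chart => f (val g)].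
have ev_inj : injective ev.
  move=> f1 f2 e12; apply: (ind_ext p_pr cardL alphaNFp alpha2Fp) => g /eqP g1.
  have := congr1 (fun f : {ffun chart -> L} => f (exist _ g g1)) e12.
  by rewrite !ffunE.
have E_linear a c d : E (a *: c + d : {ffun I -> L^o}) = a *: E c + E d.
  rewrite /E scaler_sumr -big_split; apply: eq_bigr => ij _.
  by rewrite !ffunE scalerDl scalerA.
have phi_inj : injective (ev \o psi_tensor \o E).
  move=> c d e; apply/eqP; rewrite -subr_eq0; apply/eqP.
  apply: psi_tensor_free => g /eqP g1; rewrite -/(E _).
  have -> : E (c - d) = -1 *: E d + E c by rewrite -E_linear scaleN1r addrC.
  rewrite psi_tensor_linear !ffunE.
  have := congr1 (fun f : {ffun chart -> L} => f (exist _ g g1)) e.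
  by rewrite !ffunE /= => ->; rewrite scaleN1r addNr.
have [phi' phiK phi'K] : bijective (ev \o psi_tensor \o E).
  apply: inj_card_bij phi_inj _; rewrite !card_ffun leq_pexp2l //.
    by rewrite cardL expn_gt0 prime_gt0.
  exact: card_chart.
exists (fun f => E (phi' (ev f))) => [x|f].
  by have [c ->] := tensor_span x; rewrite -/(E c) [phi' _]phiK.
by apply: ev_inj; exact: phi'K.
Qed.
End Bij.

Theorem theorem1p5 (p : nat) (p_pr : prime p)
    (L : finFieldType) (cardL : #|L| = (p ^ 2)%N)
    (iota : {rmorphism 'F_p -> L})
    (alpha : L) (alphaNFp : alpha \notin codom iota)
    (alpha2Fp : alpha ^+ 2 \in codom iota)
    (r : nat) (r_ge2 : (2 <= r)%N) (r_le : (r <= p - 1)%N) :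
  exists f : tensor (Vquot p L r) (Vsym L (p - 1)) ->
             ind (torus iota alpha) (fun t => omega2 iota alpha t ^+ r),
    rep_isomorphism
      (tensor_rep (Vquot_rep iota p_pr r) (Vsym_rep iota (p - 1)))
      (ind_rep (torus iota alpha) (fun t => omega2 iota alpha t ^+ r)) f
    /\ forall (P : Vsym L (r + p - 1)) (Q : Vsym L (p - 1)) (g : {'GL_2['F_p]}),
         f (pure (vproj (DV p L r) P) Q) g = psi iota alpha r P Q g.
Proof.
exists (psi_tensor p_pr cardL iota alpha r_ge2); split; last first.
  by move=> P Q g; rewrite psi_tensor_pure.
split.
- exact: psi_tensor_linear.
- exact: psi_tensor_bij.
- by move=> g x; exact: psi_tensor_equivariant.
Qed.
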